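(* There is a universal constant $c_0>0$ such that for all universal constants $c_1,c_2$ with $0<c_2\le c_1\le c_0$ there exists a universal constant $c_3>0$ such that the following holds. Let $\delta\in(0,1)$, $\varepsilon\in(0,1]$ and $\gamma\in[1/2,1)$. Suppose the learning rates satisfy, for all $0\le t\le T$, $$\frac{1}{1+\frac{c_1(1-\gamma)T}{\log^2 T}}\le \eta_t\le \frac{1}{1+\frac{c_2(1-\gamma)t}{\log^2 T}},$$ and the number of iterations $T$ satisfies $$T\ge \frac{c_3(\log^3 T)\,\log\frac{|\mathcal S|T}{\delta}}{(1-\gamma)^3\varepsilon^2}.$$ If the initialization obeys $0\le V_0(s)\le \frac{1}{1-\gamma}$ for all $s\in\mathcal S$, then with probability at least $1-\delta$ the synchronous TD learning iterate satisfies $\max_{s\in\mathcal S}|V_T(s)-V^\star(s)|\le\varepsilon$.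
   Context: A Markov reward process (MRP) consists of a finite state space $\mathcal S$, a transition kernel $P:\mathcal S\to\Delta(\mathcal S)$, a reward function $r:\mathcal S\to[0,1]$ and a discount factor $\gamma\in(0,1)$. Its value function is $V^\star(s)=\mathbb E\big[\sum_{k\ge0}\gamma^k r(s_k)\mid s_0=s\big]$ where $s_{k+1}\sim P(\cdot\mid s_k)$. Synchronous TD learning: in each iteration $t=1,2,\dots,T$, for every $s\in\mathcal S$ an independent sample $s_t(s)\sim P(\cdot\mid s)$ is drawn (independent across states and iterations), and $V_t(s)=(1-\eta_t)V_{t-1}(s)+\eta_t\big(r(s)+\gamma V_{t-1}(s_t(s))\big)$ for all $s$, with learning rates $\eta_t\in(0,1]$. Logarithms are natural. *)

(* Defs.v *)
From HB Require Import structures.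
From mathcomp Require Import all_boot all_order all_algebra.
From mathcomp Require Import all_classical all_reals all_analysis.
Set Implicit Arguments. Unset Strict Implicit. Unset Printing Implicit Defensive.
Import Order.TTheory GRing.Theory Num.Theory.
Local Open Scope ring_scope.

Section TD.
Variables (R : realType) (S : finType).

Definition Pop (P : S -> S -> R) (f : S -> R) : S -> R :=
  fun s => \sum_(s' : S) P s s' * f s'.

(* (P^k r)(s) = E[r(s_k) | s_0 = s] *)
Definition Pk (P : S -> S -> R) (r : S -> R) (k : nat) : S -> R :=
  iter k (Pop P) r.

(* V*(s) = E[sum_k gamma^k r(s_k) | s_0 = s] = sum_k gamma^k (P^k r)(s). *)
Definition Vstar (P : S -> S -> R) (r : S -> R) (gamma : R) (s : S) : R :=
  limn (fun n => \sum_(0 <= k < n) gamma ^+ k * Pk P r k s).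

(* Sample space for T iterations: omega i s = s_{i+1}(s) ~ P(.|s). *)
Definition Omega (T : nat) := {ffun 'I_T -> {ffun S -> S}}.

Definition prob (P : S -> S -> R) (T : nat) (w : Omega T) : R :=
  \prod_(i : 'I_T) \prod_(s : S) P s (w i s).

(* Sample used at iteration t.+1 (t < T); dummy otherwise. *)
Definition sample (T : nat) (w : Omega T) (t : nat) (s : S) : S :=
  match @insub nat (fun k => k < T)%N 'I_T t with
  | Some i => w i s
  | None => s
  end.

Fixpoint td (T : nat) (w : Omega T) (r : S -> R) (gamma : R) (eta : nat -> R)
    (V0 : S -> R) (t : nat) : S -> R :=
  match t with
  | O => V0
  | t'.+1 => fun s =>
      (1 - eta t) * td w r gamma eta V0 t' s
      + eta t * (r s + gamma * td w r gamma eta V0 t' (sample w t' s))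
  end.

End TD.

(* Main.v *)
Require Import Defs.
From HB Require Import structures.
From mathcomp Require Import all_boot all_order all_algebra.
From mathcomp Require Import all_classical all_reals all_analysis.
From mathcomp Require Import zify ring lra.
Set Implicit Arguments. Unset Strict Implicit. Unset Printing Implicit Defensive.
Import Order.TTheory GRing.Theory Num.Theory numFieldNormedType.Exports.
Local Open Scope ring_scope.

(** Let A_i = (1 - eta_i) I + eta_i gamma P, so that
    V_T - V^* = (A_T ... A_1)(V_0 - V^* )
              + sum_i eta_i gamma (A_T ... A_(i+1)) (P_i - P) V_(i-1).
    The product A_T ... A_1 is exponentially small, and the noise is a martingale
    controlled by a Bernstein bound.  Its conditional variances are summed with
    supersolutions: if f <= h - gamma P h with h >= 0, then
    sum_i eta_i (A_T ... A_(i+1)) f <= h by telescoping.  The crude variance bound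
    (1 - gamma)^-2 only yields |V_t - V^*| <= (1 - gamma)^(-1/2) for all t >= T/2;
    on that event Var(V_(i-1)) is at most 2 Var(V^* ) + 2 / (1 - gamma), and since
    Var(V^* ) admits a supersolution bounded by (1 - gamma)^-2, the accumulated
    variance drops by a factor 1 - gamma, which gives the cubic rate. *)

(** * Finite sample paths, expectations and independence *)

Section SamplePaths.
Variables (R : realType) (S : finType) (P : S -> S -> R).
Hypothesis P_ge0 : forall s s', 0 <= P s s'.
Hypothesis P_sum1 : forall s, \sum_(s' : S) P s s' = 1.

(** Functionals act on paths indexed by all of [nat], so one functional makes sense at every horizon
    [n] and induction on [n] is possible. *)
Definition Esample n (F : (nat -> S -> S) -> R) : R :=
  \sum_(w : Omega S n) prob P w * F (sample w).

Definition extend (p : nat -> S -> S) (n : nat) (x : {ffun S -> S}) :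
    nat -> S -> S :=
  fun t => if t == n then (x : S -> S) else p t.

Definition omega_rcons n (wx : Omega S n * {ffun S -> S}) : Omega S n.+1 :=
  [ffun i => if unlift ord_max i is Some j then wx.1 j else wx.2].

Definition omega_split n (w : Omega S n.+1) : Omega S n * {ffun S -> S} :=
  ([ffun j => w (lift ord_max j)], w ord_max).

Lemma omega_rconsK n : cancel (@omega_rcons n) (@omega_split n).
Proof.
case=> w x; rewrite /omega_split /omega_rcons; congr pair.
  by apply/ffunP => j; rewrite !ffunE liftK.
by rewrite ffunE unlift_none.
Qed.

Lemma omega_splitK n : cancel (@omega_split n) (@omega_rcons n).
Proof.
move=> w; apply/ffunP => i; rewrite !ffunE /=.
by case: unliftP => [j ->|->]; rewrite ?ffunE.
Qed.

Lemma prob_omega_rcons n w x :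
  prob P (@omega_rcons n (w, x)) = prob P w * \prod_s P s (x s).
Proof.
rewrite /prob big_ord_recr /=; congr (_ * _).
  apply: eq_bigr => i _; apply: eq_bigr => s _.
  have -> : widen_ord (leqnSn n) i = lift ord_max i.
    by apply: val_inj; rewrite /= /bump leqNgt ltn_ord.
  by rewrite ffunE liftK.
by apply: eq_bigr => s _; rewrite ffunE unlift_none.
Qed.

Lemma sample_omega_rcons n w x :
  sample (@omega_rcons n (w, x)) = extend (sample w) n x.
Proof.
apply/funext => t; apply/funext => s; rewrite /sample /extend.
case: ltngtP => [tn|tn|->].
- rewrite !insubT //= ?(ltnW tn)//; first exact: leqW.
  move=> t1; rewrite ffunE.
  have -> : Sub t t1 = lift ord_max (Sub t tn : 'I_n) :> 'I_n.+1.
    by apply: val_inj; rewrite /= /bump leqNgt tn.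
  by rewrite liftK.
- by rewrite !insubF // ltnNge ?(ltnW tn)// tn.
- rewrite insubT //= => nn; rewrite ffunE.
  have -> : Sub n nn = ord_max :> 'I_n.+1 by apply: val_inj.
  by rewrite unlift_none.
Qed.

(** The weight of a path factors into that of its first [n] samples and that of the last one. This
    is the conditioning step behind every induction on the horizon. *)
Lemma EsampleS n F : Esample n.+1 F =
  Esample n (fun p => \sum_(x : {ffun S -> S})
    (\prod_s P s (x s)) * F (extend p n x)).
Proof.
rewrite /Esample (reindex (@omega_rcons n)); last first.
  by apply: onW_bij; exists (@omega_split n);
    [exact: omega_rconsK | exact: omega_splitK].
under [RHS]eq_bigr do rewrite big_distrr /=.
rewrite pair_big /=; apply: eq_bigr => -[w x] _ /=.
by rewrite prob_omega_rcons sample_omega_rcons mulrA.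
Qed.

(** Without any draw, [sample] always returns its default, the state itself; hence the identity
    path. *)
Lemma Esample0 F : Esample 0 F = F (fun _ => id).
Proof.
rewrite /Esample (bigD1 [ffun=> [ffun s => s]]) //= big1 ?addr0; last first.
  by move=> w /eqP[]; apply/ffunP => -[].
rewrite /prob big_ord0 mul1r; congr F.
by apply/funext => t; apply/funext => s; rewrite /sample insubF.
Qed.

Lemma prob_ge0 n (w : Omega S n) : 0 <= prob P w.
Proof. by apply: prodr_ge0 => i _; apply: prodr_ge0. Qed.

Lemma Esample_le n F G : (forall p, F p <= G p) -> Esample n F <= Esample n G.
Proof. by move=> FG; apply: ler_sum => w _; rewrite ler_wpM2l ?prob_ge0. Qed.

Lemma EsampleM n c F : Esample n (fun p => F p * c) = Esample n F * c.
Proof. by rewrite /Esample big_distrl /=; apply: eq_bigr => w _; rewrite mulrA. Qed.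

Lemma Esample_cst n : Esample n (fun=> 1) = 1.
Proof.
elim: n => [|n IH]; first by rewrite Esample0.
rewrite EsampleS -[RHS]IH; apply: eq_bigr => w _; congr (_ * _).
under eq_bigr do rewrite mulr1.
by rewrite -(bigA_distr_bigA P) /= big1.
Qed.

Lemma prob_sum1 n : \sum_(w : Omega S n) prob P w = 1.
Proof.
by rewrite -(Esample_cst n) /Esample; apply: eq_bigr => w _; rewrite mulr1.
Qed.

Definition varP (U : S -> R) (s : S) : R :=
  \sum_(s' : S) P s s' * (U s' - Pop P U s) ^+ 2.

Lemma Pop_centered (U : S -> R) s :
  \sum_(s' : S) P s s' * (U s' - Pop P U s) = 0.
Proof.
under eq_bigr do rewrite mulrBr.
by rewrite sumrB -big_distrl /= P_sum1 mul1r subrr.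
Qed.

(** From [1 - x <= expR (- x)] follows [expR x * (1 - x) <= 1], while the quadratic times [1 - x]
    equals [1 + x ^+ 2 * (1 - 2 * x)], which is at least 1. *)
Lemma expR_le_quad (x : R) : x <= 2^-1 -> expR x <= 1 + x + 2 * x ^+ 2.
Proof.
move=> xh; have h : 1 - x <= expR (- x) by exact: expR_ge1Dx.
have e0 := expR_gt0 x.
have : expR x * (1 - x) <= 1.
  by rewrite -[leRHS](expRxMexpNx_1 x) ler_pM2l.
have : 1 <= (1 + x + 2 * x ^+ 2) * (1 - x).
  rewrite -subr_ge0.
  have -> : (1 + x + 2 * x ^+ 2) * (1 - x) - 1 = x ^+ 2 * (1 - 2 * x) by ring.
  by apply: mulr_ge0; [exact: sqr_ge0 | lra].
move=> h1 h2; have x1 : 0 < 1 - x by lra.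
by rewrite -(ler_pM2r x1); apply: le_trans h1.
Qed.

(** After the quadratic bound on the exponential, the linear term vanishes by centering, and
    [1 + z <= expR z] finishes. *)
Lemma mgf_state (a : R) (U : S -> R) s :
  (forall y, `|a * (U y - Pop P U s)| <= 2^-1) ->
  \sum_y P s y * expR (a * (U y - Pop P U s))
    <= expR (2 * (a ^+ 2 * varP U s)).
Proof.
move=> aU; apply: le_trans (expR_ge1Dx _).
apply: (@le_trans _ _ (\sum_y (P s y + a * (P s y * (U y - Pop P U s)) +
    2 * (a ^+ 2 * (P s y * (U y - Pop P U s) ^+ 2))))).
  apply: ler_sum => y _.
  apply: (@le_trans _ _ (P s y * (1 + a * (U y - Pop P U s) +
     2 * (a * (U y - Pop P U s)) ^+ 2))).
    rewrite ler_wpM2l // expR_le_quad //.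
    by apply: le_trans (aU y); exact: ler_norm.
  by rewrite le_eqVlt; apply/orP; left; apply/eqP; ring.
rewrite !big_split /= -!big_distrr /= P_sum1 Pop_centered mulr0 addr0.
exact: lexx.
Qed.

(** Samples at distinct states are independent, so the sum over all [x] factors into a product of
    one-state sums. *)
Lemma mgf_step (a : S -> R) (U : S -> R) :
  (forall s y, `|a s * (U y - Pop P U s)| <= 2^-1) ->
  \sum_(x : {ffun S -> S}) (\prod_s P s (x s)) *
      expR (\sum_s a s * (U (x s) - Pop P U s))
    <= expR (2 * \sum_s a s ^+ 2 * varP U s).
Proof.
move=> aU; under eq_bigr do rewrite expR_sum -big_split /=.
rewrite -(bigA_distr_bigA
  (fun s y => P s y * expR (a s * (U y - Pop P U s)))) /=.
rewrite big_distrr /= expR_sum; apply: ler_prod => s _.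
rewrite mgf_state // andbT.
by apply: sumr_ge0 => y _; rewrite mulr_ge0 ?expR_ge0.
Qed.

(** * Bernstein-type tail bound for adapted noise *)

Section Martingale.
Variables (U : nat -> (nat -> S -> S) -> S -> R).
Hypothesis U_adapted : forall i p q,
  (forall j, (j < i)%N -> p j = q j) -> U i p = U i q.

(** Increment [i] evaluates [U i p], a function of earlier samples only, at the fresh sample [p i];
    its conditional mean is therefore zero. *)
Definition mart (a : nat -> S -> R) (n : nat) (p : nat -> S -> S) : R :=
  \sum_(i < n) \sum_s a i s * (U i p (p i s) - Pop P (U i p) s).

Lemma mart_extend a n p x : mart a n.+1 (extend p n x) =
  mart a n p + \sum_s a n s * (U n p (x s) - Pop P (U n p) s).
Proof.
rewrite /mart big_ord_recr /=; congr (_ + _).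
  apply: eq_bigr => i _; apply: eq_bigr => s _.
  rewrite (@U_adapted i (extend p n x) p).
    by rewrite /extend (ltn_eqF (ltn_ord i)).
  by move=> j ji; rewrite /extend (ltn_eqF (ltn_trans ji (ltn_ord i))).
apply: eq_bigr => s _; rewrite (@U_adapted n (extend p n x) p).
  by rewrite /extend eqxx.
by move=> j ji; rewrite /extend (ltn_eqF ji).
Qed.

(** Given the first [n] samples, the last increment contributes at most a deterministic factor,
    because [v] does not depend on the path; that factor leaves the expectation. *)
Lemma mgf_mart (a v : nat -> S -> R) n :
  (forall i p s y, (i < n)%N ->
     `|a i s * (U i p y - Pop P (U i p) s)| <= 2^-1) ->
  (forall i p s, (i < n)%N -> varP (U i p) s <= v i s) ->
  Esample n (fun p => expR (mart a n p))
    <= expR (2 * \sum_(i < n) \sum_s a i s ^+ 2 * v i s).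
Proof.
elim: n => [|n IH] ha hv.
  by rewrite Esample0 /mart !big_ord0 mulr0.
rewrite EsampleS big_ord_recr /= mulrDr expRD.
apply: le_trans (_ : Esample n (fun p => expR (mart a n p) *
    expR (2 * \sum_s a n s ^+ 2 * v n s)) <= _).
  apply: Esample_le => p; under eq_bigr do
    rewrite mart_extend expRD mulrCA.
  rewrite -big_distrr /= ler_wpM2l ?expR_ge0 //.
  apply: le_trans (mgf_step _) _; first by move=> s y; apply: ha.
  rewrite ler_expR ler_wpM2l //; apply: ler_sum => s _.
  by rewrite ler_wpM2l ?sqr_ge0 // hv.
rewrite EsampleM ler_wpM2r ?expR_ge0 // IH //.
- by move=> i p s y /ltnW; exact: ha.
- by move=> i p s /ltnW; exact: hv.
Qed.

(** Chernoff's method with [lam = 2 * L / u]. The two smallness conditions amount to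
    [lam * b <= 1/2] and [2 * lam ^+ 2 * W <= L], so the exponent [2 * lam ^+ 2 * W - lam * u] is at
    most [L - 2 * L]. *)
Lemma mart_tail (a v : nat -> S -> R) n (b u L W : R) :
  0 < u -> 0 < L -> 4 * L * b <= u -> 8 * L * W <= u ^+ 2 ->
  (forall i p s y, (i < n)%N ->
     `|a i s * (U i p y - Pop P (U i p) s)| <= b) ->
  (forall i p s, (i < n)%N -> varP (U i p) s <= v i s) ->
  \sum_(i < n) \sum_s a i s ^+ 2 * v i s <= W ->
  \sum_(w : Omega S n | u < mart a n (sample w)) prob P w <= expR (- L).
Proof.
move=> u0 L0 Lb LW ha hv hW; pose lam := 2 * L / u.
have lam0 : 0 < lam by rewrite divr_gt0 ?mulr_gt0.
have lamu : lam * u = 2 * L by rewrite /lam divfK ?gt_eqF.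
have scale p : mart (fun i s => lam * a i s) n p = lam * mart a n p.
  rewrite /mart big_distrr; apply: eq_bigr => i _.
  by rewrite big_distrr; apply: eq_bigr => s _; rewrite /= mulrA.
have mgf : Esample n (fun p => expR (lam * mart a n p))
    <= expR (2 * (lam ^+ 2 * W)).
  apply: le_trans (_ : Esample n (fun p => expR
     (mart (fun i s => lam * a i s) n p)) <= _).
    by apply: Esample_le => p; rewrite scale.
  apply: le_trans (@mgf_mart _ v _ _ hv) _.
    move=> i p s y ilt; rewrite -mulrA normrM (gtr0_norm lam0).
    apply: le_trans (_ : lam * b <= _); first by rewrite ler_pM2l // ha.
    by rewrite -(ler_pM2r u0) -mulrA (mulrC b) mulrA lamu; lra.
  rewrite ler_expR ler_pM2l //; under eq_bigr do
    under eq_bigr do rewrite exprMn -mulrA.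
  under eq_bigr do rewrite -big_distrr /=.
  by rewrite -big_distrr /= ler_pM2l // exprn_gt0.
have markov : \sum_(w : Omega S n | u < mart a n (sample w)) prob P w
    <= Esample n (fun p => expR (lam * mart a n p)) * expR (- (lam * u)).
  rewrite /Esample big_distrl /= big_mkcond /=; apply: ler_sum => w _.
  case: ifP => [uw|_]; last by rewrite !mulr_ge0 ?expR_ge0 ?prob_ge0.
  rewrite -mulrA ler_peMr ?prob_ge0 // -expRD -[leLHS](@expR0 R) ler_expR.
  by rewrite subr_ge0 ler_pM2l // ltW.
apply: le_trans markov _.
apply: le_trans (_ : expR (2 * (lam ^+ 2 * W)) * expR (- (lam * u)) <= _).
  by rewrite ler_wpM2r ?expR_ge0.
rewrite -expRD ler_expR lamu.
suff : 2 * (lam ^+ 2 * W) <= L by lra.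
rewrite -(ler_pM2r (_ : 0 < u ^+ 2)) ?exprn_gt0 //.
have -> : 2 * (lam ^+ 2 * W) * u ^+ 2 = L * (8 * L * W).
  have -> : 2 * (lam ^+ 2 * W) * u ^+ 2 = 2 * W * (lam * u) ^+ 2 by ring.
  by rewrite lamu; ring.
by rewrite ler_pM2l.
Qed.

Lemma mart_tail_abs (a v : nat -> S -> R) n (b u L W : R) :
  0 < u -> 0 < L -> 4 * L * b <= u -> 8 * L * W <= u ^+ 2 ->
  (forall i p s y, (i < n)%N ->
     `|a i s * (U i p y - Pop P (U i p) s)| <= b) ->
  (forall i p s, (i < n)%N -> varP (U i p) s <= v i s) ->
  \sum_(i < n) \sum_s a i s ^+ 2 * v i s <= W ->
  \sum_(w : Omega S n | u < `|mart a n (sample w)|) prob P w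
    <= 2 * expR (- L).
Proof.
move=> u0 L0 Lb LW ha hv hW.
have neg p : mart (fun i s => - a i s) n p = - mart a n p.
  rewrite /mart -sumrN; apply: eq_bigr => i _.
  by rewrite -sumrN; apply: eq_bigr => s _; rewrite mulNr.
have t1 := @mart_tail a v n b u L W u0 L0 Lb LW ha hv hW.
have t2 : \sum_(w : Omega S n | u < mart (fun i s => - a i s) n (sample w))
    prob P w <= expR (- L).
  apply: (@mart_tail _ v n b u L W) => //.
  - by move=> i p s y ilt; rewrite mulNr normrN ha.
  - by under eq_bigr do under eq_bigr do rewrite sqrrN.
apply: le_trans (_ : _ <= expR (- L) + expR (- L)) _; last lra.
apply: le_trans (lerD t1 t2).
rewrite [leLHS]big_mkcond [X in _ <= X + _]big_mkcond.
rewrite [X in _ <= _ + X]big_mkcond -big_split /=; apply: ler_sum => w _.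
rewrite neg lter_normr; have := @prob_ge0 n w.
by case: (u < mart _ _ _); case: (u < - _) => //=; lra.
Qed.

End Martingale.
End SamplePaths.

(** * Transition operator, one-step variance and value function *)

Section Value.
Variables (R : realType) (S : finType) (P : S -> S -> R) (r : S -> R).
Variable gamma : R.
Hypothesis P_ge0 : forall s s', 0 <= P s s'.
Hypothesis P_sum1 : forall s, \sum_(s' : S) P s s' = 1.
Hypothesis r01 : forall s, 0 <= r s <= 1.
Hypothesis g01 : 0 <= gamma < 1.

Local Notation G := ((1 - gamma)^-1).

Lemma Pop_le (f h : S -> R) s : (forall y, f y <= h y) -> Pop P f s <= Pop P h s.
Proof. by move=> fh; apply: ler_sum => y _; rewrite ler_wpM2l. Qed.

Lemma PopD (f h : S -> R) s :
  Pop P (fun y => f y + h y) s = Pop P f s + Pop P h s.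
Proof. by rewrite /Pop -big_split; apply: eq_bigr => y _; rewrite mulrDr. Qed.

Lemma PopB (f h : S -> R) s :
  Pop P (fun y => f y - h y) s = Pop P f s - Pop P h s.
Proof. by rewrite /Pop -sumrB; apply: eq_bigr => y _; rewrite mulrBr. Qed.

Lemma PopZ c (f : S -> R) s : Pop P (fun y => c * f y) s = c * Pop P f s.
Proof. by rewrite /Pop big_distrr; apply: eq_bigr => y _; rewrite mulrCA. Qed.

Lemma Pop_cst c s : Pop P (fun=> c) s = c.
Proof. by rewrite /Pop -big_distrl /= P_sum1 mul1r. Qed.

Lemma Pop_ge0 (f : S -> R) s : (forall y, 0 <= f y) -> 0 <= Pop P f s.
Proof. by move=> f0; apply: sumr_ge0 => y _; rewrite mulr_ge0. Qed.

Lemma Pop_range (a b : R) (f : S -> R) s : (forall y, a <= f y <= b) ->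
  a <= Pop P f s <= b.
Proof.
move=> fab; apply/andP; split;
  [rewrite -[leLHS](Pop_cst a s) | rewrite -[leRHS](Pop_cst b s)];
  by apply: Pop_le => y; case/andP: (fab y).
Qed.

Lemma varPE (U : S -> R) s :
  varP P U s = Pop P (fun y => U y ^+ 2) s - Pop P U s ^+ 2.
Proof.
pose c := Pop P U s.
have -> : varP P U s = Pop P (fun y => U y ^+ 2 - 2 * c * U y + c ^+ 2) s.
  by apply: eq_bigr => y _; rewrite -/c; congr (_ * _); ring.
by rewrite PopD PopB PopZ Pop_cst -/c; ring.
Qed.

Lemma varP_le_sqr (U : S -> R) s c :
  (forall y, `|U y| <= c) -> varP P U s <= c ^+ 2.
Proof.
move=> Uc; rewrite varPE -[leRHS](Pop_cst _ s) lerBlDr.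
rewrite -[leLHS]addr0; apply: lerD; last exact: sqr_ge0.
by apply: Pop_le => y; rewrite -real_normK ?num_real // lerXn2r ?nnegrE // (le_trans _ (Uc y)).
Qed.

(** The integrands differ by the square of the difference of the two centered functions. *)
Lemma varPD_le (U D : S -> R) s :
  varP P (fun y => U y + D y) s <= 2 * varP P U s + 2 * varP P D s.
Proof.
rewrite /varP !big_distrr -big_split /=; apply: ler_sum => y _.
rewrite PopD ![2 * (_ * _)]mulrCA -mulrDr ler_wpM2l //.
set a := Pop P U s; set b := Pop P D s; rewrite -subr_ge0.
have -> : (U y - a) * (2 * (U y - a)) + (D y - b) * (2 * (D y - b)) -
    (U y + D y - (a + b)) ^+ 2
  = ((U y - a) - (D y - b)) ^+ 2 by ring.
exact: sqr_ge0.
Qed.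

Let partial n s := \sum_(0 <= k < n) gamma ^+ k * Pk P r k s.

Lemma G_gt0 : 0 < G. Proof. by case/andP: g01 => _ g1; rewrite invr_gt0 subr_gt0. Qed.

Lemma G_fix : 1 + gamma * G = G.
Proof.
have n0 : 1 - gamma != 0 by case/andP: g01 => _ g1; rewrite subr_eq0 gt_eqF.
by apply: (mulIf n0); rewrite mulrDl -mulrA mulVf //; ring.
Qed.

Lemma partialS n s : partial n.+1 s = r s + gamma * Pop P (partial n) s.
Proof.
rewrite /partial big_nat_recl //= expr0 mul1r; congr (_ + _).
under eq_bigr do rewrite exprS -mulrA.
rewrite -big_distrr /=; congr (_ * _); rewrite /Pop.
under [RHS]eq_bigr do rewrite big_distrr /=.
rewrite exchange_big /=; apply: eq_bigr => k _.
by rewrite big_distrr; apply: eq_bigr => y _; rewrite mulrCA.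
Qed.

Lemma partial_range n s : 0 <= partial n s <= G.
Proof.
elim: n s => [|n IH] s.
  by rewrite /partial big_geq // lexx ltW // G_gt0.
rewrite partialS; have /andP[p0 pG] := Pop_range s IH.
have /andP[r0 r1] := r01 s; case/andP: g01 => g0 g1; rewrite addr_ge0 //=.
  by rewrite -G_fix lerD // ler_wpM2l.
by rewrite mulr_ge0.
Qed.

Lemma partial_nondecr s : {homo partial^~ s : n m / (n <= m)%N >-> n <= m}.
Proof.
apply: homo_leq => // [|n]; first by move=> x y z; exact: le_trans.
rewrite /partial big_nat_recr //= lerDl mulr_ge0 ?exprn_ge0 //.
  by case/andP: g01.
elim: n s => [|n IH] s; first by case/andP: (r01 s).
exact: Pop_ge0.
Qed.

(** [Vstar] is a [limn], informative only once convergence is known: the partial sums are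
    nondecreasing and bounded by [G]. *)
Lemma partial_cvg s : (partial^~ s @ \oo --> Vstar P r gamma s)%classic.
Proof.
apply: nondecreasing_is_cvgn; first exact: partial_nondecr.
by exists G => _ [n _ <-]; case/andP: (partial_range n s).
Qed.

Lemma Vstar_range s : 0 <= Vstar P r gamma s <= G.
Proof.
apply/andP; split.
- apply: limr_ge; first exact: partial_cvg.
  by apply: nearW => n; case/andP: (partial_range n s).
- apply: limr_le; first exact: partial_cvg.
  by apply: nearW => n; case/andP: (partial_range n s).
Qed.

Lemma Vstar_bellman s :
  Vstar P r gamma s = r s + gamma * Pop P (Vstar P r gamma) s.
Proof.
have c1 : ((fun n => partial n.+1 s) @ \oo --> Vstar P r gamma s)%classic.
  by have := @partial_cvg s; rewrite -cvg_shiftS.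
have c2 : ((fun n => partial n.+1 s) @ \oo -->
    (r s + gamma * Pop P (Vstar P r gamma) s)%R)%classic.
  under eq_fun do rewrite partialS.
  apply: cvgD; first exact: cvg_cst.
  apply: cvgM; first exact: cvg_cst.
  apply: cvg_big; first exact: add_continuous.
  by move=> y _; apply: cvgM; [exact: cvg_cst | exact: partial_cvg].
exact: (cvg_unique (@norm_hausdorff _ R^o) c1 c2).
Qed.

(* [2 G V - V^2] is a supersolution for the one-step variance of [V], because
   [gamma * P V = V - r]; being at most [G^2], it turns the naive bound [G^3]
   on the accumulated variance into [G^2]. *)
Definition var_super (s : S) : R :=
  2 * G * Vstar P r gamma s - Vstar P r gamma s ^+ 2.

Lemma var_super_ge0 s : 0 <= var_super s.
Proof.
have /andP[v0 vG] := Vstar_range s.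
rewrite /var_super expr2 -mulrBl mulr_ge0 //; have := G_gt0; lra.
Qed.

Lemma var_super_le s : var_super s <= G ^+ 2.
Proof.
rewrite /var_super -subr_ge0.
by rewrite (_ : _ - _ = (G - Vstar P r gamma s) ^+ 2) ?sqr_ge0 //; ring.
Qed.

Lemma var_superP s :
  gamma ^+ 2 * varP P (Vstar P r gamma) s
    <= var_super s - gamma * Pop P var_super s.
Proof.
have /andP[r0 _] := r01 s; have /andP[v0 vG] := Vstar_range s.
have G0 := G_gt0; case/andP: (g01) => g0 g1.
have bell := Vstar_bellman s.
have Q0 : 0 <= Pop P (fun y => Vstar P r gamma y ^+ 2) s.
  by apply: Pop_ge0 => y; exact: sqr_ge0.
rewrite varPE {2}/var_super PopB PopZ /var_super.
move: bell; set v := Vstar P r gamma s; set q := Pop P (fun y => _ ^+ 2) s in Q0 *.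
set m := Pop P _ s => bell.
rewrite -subr_ge0.
(* Writing [r s] as [v - gamma * m] turns the gap into a sum of terms that are nonnegative because
   [v <= G]. *)
have -> : 2 * G * v - v ^+ 2 - gamma * (2 * G * m - q) -
    gamma ^+ 2 * (q - m ^+ 2) = 2 * r s * (G - v) + r s ^+ 2
      + gamma * (1 - gamma) * q.
  have -> : r s = v - gamma * m by rewrite bell; ring.
  ring.
rewrite !addr_ge0 ?sqr_ge0 //.
- by rewrite !mulr_ge0 // subr_ge0.
- by rewrite !mulr_ge0 // subr_ge0 ltW.
Qed.

End Value.

(** * TD iterates along a path and products of averaged steps *)

Section Iterates.
Variables (R : realType) (S : finType) (P : S -> S -> R) (r : S -> R).
Variables (gamma : R) (eta : nat -> R) (V0 : S -> R).
Hypothesis P_ge0 : forall s s', 0 <= P s s'.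
Hypothesis P_sum1 : forall s, \sum_(s' : S) P s s' = 1.
Hypothesis r01 : forall s, 0 <= r s <= 1.
Hypothesis g01 : 0 <= gamma < 1.

Local Notation G := ((1 - gamma)^-1).
Local Notation Vs := (Vstar P r gamma).

(** The recursion of [td] on infinite paths: it carries no horizon, so adaptedness can be stated. *)
Fixpoint td_path (t : nat) (p : nat -> S -> S) : S -> R :=
  if t is t'.+1 then fun s =>
    (1 - eta t) * td_path t' p s
    + eta t * (r s + gamma * td_path t' p (p t' s))
  else V0.

Lemma td_sample T (w : Omega S T) t :
  td w r gamma eta V0 t = td_path t (sample w).
Proof. by elim: t => //= t ->. Qed.

Lemma td_path_adapted t p q : (forall j, (j < t)%N -> p j = q j) ->
  td_path t p = td_path t q.
Proof.
elim: t => //= t IH pq; rewrite (IH (fun j jt => pq j (leqW jt))).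
by rewrite (pq t).
Qed.

(** Each update is a convex combination of an old value and a target, and [1 + gamma * G = G] keeps
    targets in [[0, G]]. *)
Lemma td_path_range T t p s :
  (forall t, (1 <= t <= T)%N -> 0 < eta t <= 1) ->
  (forall s, 0 <= V0 s <= G) -> (t <= T)%N -> 0 <= td_path t p s <= G.
Proof.
move=> he hV; elim: t s => [|t IH] s tT; first exact: hV.
have /andP[e0 e1] := he t.+1 tT.
have /andP[a0 aG] := IH s (ltnW tT).
have /andP[b0 bG] := IH (p t s) (ltnW tT).
have /andP[r0 r1] := r01 s; case/andP: (g01) => g0 g1.
have e10 : 0 <= 1 - eta t.+1 by rewrite subr_ge0.
rewrite /=; apply/andP; split.
  apply: addr_ge0; first exact: mulr_ge0.
  by apply: mulr_ge0; [exact: ltW | rewrite addr_ge0 // mulr_ge0].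
have -> : G = (1 - eta t.+1) * G + eta t.+1 * (1 + gamma * G).
  by rewrite (G_fix g01); ring.
rewrite lerD // ?ler_wpM2l //; first exact: ltW.
by rewrite lerD // ler_wpM2l.
Qed.

(* Row [s0] of the matrix A_t ... A_(t-k+1), A_i = (1 - eta_i) I + eta_i gamma P. *)
Fixpoint prod_row_rec (t : nat) (s0 : S) (k : nat) : S -> R :=
  if k is k'.+1 then fun s =>
    (1 - eta (t - k')) * prod_row_rec t s0 k' s
    + eta (t - k') * gamma * \sum_y prod_row_rec t s0 k' y * P y s
  else fun s => (s == s0)%:R.

Definition prod_row (t : nat) (s0 : S) (i : nat) : S -> R := prod_row_rec t s0 (t - i).

Lemma row_last t s0 s : prod_row t s0 t s = (s == s0)%:R.
Proof. by rewrite /prod_row subnn. Qed.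

Lemma rowE t s0 i s : (i < t)%N -> prod_row t s0 i s =
  (1 - eta i.+1) * prod_row t s0 i.+1 s
    + eta i.+1 * gamma * \sum_y prod_row t s0 i.+1 y * P y s.
Proof. by move=> it; rewrite /prod_row -(subnSK it) /= subKn. Qed.

(** Associativity: the rightmost factor [A_(i+1)] acts on [f] instead of on the row. *)
Lemma row_pair t s0 i (f : S -> R) : (i < t)%N ->
  \sum_s prod_row t s0 i s * f s =
  \sum_s prod_row t s0 i.+1 s *
    ((1 - eta i.+1) * f s + eta i.+1 * gamma * Pop P f s).
Proof.
move=> it; under eq_bigr do rewrite (rowE _ _ it) mulrDl.
under [RHS]eq_bigr do rewrite mulrDr.
rewrite !big_split /=; congr (_ + _).
  by apply: eq_bigr => s _; ring.
transitivity (\sum_s \sum_y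
    eta i.+1 * gamma * (prod_row t s0 i.+1 y * P y s * f s)).
  apply: eq_bigr => s _; rewrite -mulrA big_distrl big_distrr /=.
  by rewrite -big_distrr.
rewrite exchange_big /=; apply: eq_bigr => y _.
rewrite /Pop -big_distrr /= mulrCA; congr (_ * _).
by rewrite big_distrr; apply: eq_bigr => s _; rewrite /= mulrA.
Qed.

(** * Sign, mass and weighted sums of the product rows *)

Section Weights.
Variables (T t : nat) (s0 : S).
Hypothesis eta01 : forall t, (1 <= t <= T)%N -> 0 < eta t <= 1.
Hypothesis tT : (t <= T)%N.

Lemma row_ge0 i s : (i <= t)%N -> 0 <= prod_row t s0 i s.
Proof.
move=> it; have [k ->] : exists k, i = (t - k)%N.
  by exists (t - i)%N; rewrite subKn.
elim: k s => [|k IH] s; first by rewrite subn0 row_last.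
(* Once [k >= t], truncated subtraction freezes the index at 0 and the induction hypothesis is the
   claim. *)
have [kt|tk] := ltnP k t; last first.
  by have -> : (t - k.+1 = t - k)%N by lia.
have lt : (t - k.+1 < t)%N by lia.
have e : (t - k.+1).+1 = (t - k)%N by lia.
have /andP[e0 e1] : 0 < eta (t - k) <= 1 by apply: eta01; lia.
case/andP: g01 => g0 g1; rewrite rowE // e addr_ge0 // mulr_ge0 //.
- by rewrite subr_ge0.
- by rewrite mulr_ge0 // ltW.
- by apply: sumr_ge0 => y _; rewrite mulr_ge0.
Qed.

(** Pair the row with the constant 1: [A_j] maps it to [1 - (1 - gamma) * eta j], at most
    [1 - (1 - gamma) * elow]. *)
Lemma row_mass (elow : R) i :
  (forall j, (1 <= j <= T)%N -> elow <= eta j) -> (1 - gamma) * elow <= 1 ->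
  (i <= t)%N ->
  \sum_s prod_row t s0 i s <= (1 - (1 - gamma) * elow) ^+ (t - i).
Proof.
move=> elo elo1 it.
have [k [kt ->]] : exists k, (k <= t)%N /\ i = (t - k)%N.
  by exists (t - i)%N; rewrite subKn // leq_subr.
rewrite subKn //; elim: k kt => [|k IH] kt.
  rewrite subn0 expr0 (bigD1 s0) //= row_last eqxx big1 ?addr0 //.
  by move=> s /negPf sn; rewrite row_last sn.
have lt : (t - k.+1 < t)%N by lia.
have e : (t - k.+1).+1 = (t - k)%N by lia.
have el : elow <= eta (t - k) by apply: elo; lia.
have := @row_pair t s0 (t - k.+1) (fun=> 1) lt; rewrite e.
under eq_bigr do rewrite mulr1.
move=> ->; under eq_bigr do rewrite (Pop_cst P_sum1) !mulr1.
rewrite -big_distrl /= mulrC exprS.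
have m0 : 0 <= \sum_s prod_row t s0 (t - k) s.
  by apply: sumr_ge0 => s _; rewrite row_ge0 // leq_subr.
case/andP: g01 => g0 g1.
apply: le_trans (_ : (1 - (1 - gamma) * elow) * \sum_s prod_row t s0 (t - k) s <= _).
  rewrite ler_wpM2r // -subr_ge0.
  have -> : 1 - (1 - gamma) * elow - (1 - eta (t - k) + eta (t - k) * gamma)
    = (1 - gamma) * (eta (t - k) - elow) by ring.
  by rewrite mulr_ge0 // subr_ge0 // ltW.
by rewrite ler_wpM2l ?subr_ge0 // IH // ltnW.
Qed.

Lemma row_le_mass i s : (i <= t)%N -> prod_row t s0 i s <= \sum_y prod_row t s0 i y.
Proof.
move=> it; rewrite (bigD1 s) //= lerDl; apply: sumr_ge0 => y _.
exact: row_ge0.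
Qed.

(** Since [h - A_j h = eta_j (h - gamma P h)], each summand is at most the increment of [W], the row
    paired with [h]. *)
Lemma row_super (f h : S -> R) : (forall s, 0 <= h s) ->
  (forall s, f s <= h s - gamma * Pop P h s) ->
  \sum_(i < t) \sum_s eta i.+1 * prod_row t s0 i.+1 s * f s <= h s0.
Proof.
move=> h0 fh; pose W i := \sum_s prod_row t s0 i s * h s.
have Wt : W t = h s0.
  rewrite /W (bigD1 s0) //= row_last eqxx mul1r big1 ?addr0 // => s /negPf sn.
  by rewrite row_last sn mul0r.
apply: le_trans (_ : \sum_(0 <= i < t) (W i.+1 - W i) <= _).
  rewrite big_mkord; apply: ler_sum => -[i it] _ /=.
  rewrite /W (row_pair _ _ it) -sumrB; apply: ler_sum => s _.
  have -> : prod_row t s0 i.+1 s * h s - prod_row t s0 i.+1 s *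
      ((1 - eta i.+1) * h s + eta i.+1 * gamma * Pop P h s) =
      eta i.+1 * prod_row t s0 i.+1 s * (h s - gamma * Pop P h s) by ring.
  rewrite ler_wpM2l // mulr_ge0 ?row_ge0 //.
  by have /andP[/ltW] := eta01 (t := i.+1) (leq_trans it tT).
rewrite telescope_sumr // Wt lerBlDr lerDl; apply: sumr_ge0 => s _.
by rewrite mulr_ge0 // row_ge0.
Qed.

(** Telescope the row paired with the error [D i]; by the Bellman equation each increment reduces to
    the sampling noise. *)
Lemma error_decomp (p : nat -> S -> S) :
  td_path t p s0 - Vs s0 =
  \sum_s prod_row t s0 0 s * (V0 s - Vs s) +
  \sum_(i < t) \sum_s eta i.+1 * gamma * prod_row t s0 i.+1 s *
    (td_path i p (p i s) - Pop P (td_path i p) s).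
Proof.
pose D i s := td_path i p s - Vs s.
pose W i := \sum_s prod_row t s0 i s * D i s.
have Wt : W t = td_path t p s0 - Vs s0.
  rewrite /W (bigD1 s0) //= row_last eqxx mul1r big1 ?addr0 // => s /negPf sn.
  by rewrite row_last sn mul0r.
have := @telescope_sumr R 0 t W (leq0n t); rewrite Wt => tele.
rewrite [LHS](_ : _ = W 0 + \sum_(0 <= k < t) (W k.+1 - W k)); last first.
  by rewrite tele [RHS]addrC subrK.
congr (_ + _); rewrite big_mkord; apply: eq_bigr => -[i it] _ /=.
rewrite /W (row_pair _ _ it) -sumrB; apply: eq_bigr => s _.
rewrite /D /= PopB (Vstar_bellman P_ge0 P_sum1 r01 g01 s).
ring.
Qed.

End Weights.

End Iterates.

(** * Index arithmetic, union bound and squared weights *)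

Lemma quarter_gap T t i : (T <= 2 * t)%N -> (4 * i.+1 <= T)%N ->
  (T <= 4 * (t - i.+1))%N.
Proof. lia. Qed.

Lemma half_gap T i : (1 < T)%N -> (2 * i < T)%N -> (T <= 4 * (T - i.+1))%N.
Proof. lia. Qed.

Lemma sum_union_le (R : realType) (W I : finType) (f : W -> R)
    (B : pred W) (A : I -> pred W) (c : R) :
  (forall w, 0 <= f w) -> (forall w, B w -> exists i, A i w) ->
  (forall i, \sum_(w | A i w) f w <= c) ->
  \sum_(w | B w) f w <= #|I|%:R * c.
Proof.
move=> f0 BA Ac; apply: (@le_trans _ _ (\sum_i \sum_(w | A i w) f w)).
  under [leRHS]eq_bigr do rewrite big_mkcond /=.
  rewrite exchange_big big_mkcond /=; apply: ler_sum => w _.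
  have nn i : 0 <= (if A i w then f w else 0) by case: ifP.
  case: ifP => [/BA[i Ai]|_]; last exact: sumr_ge0.
  by rewrite (bigD1 i) //= Ai lerDl; apply: sumr_ge0.
apply: le_trans (ler_sum _ (fun i _ => Ac i)) _.
by rewrite sumr_const mulr_natl.
Qed.

(** One factor of the squared weight is traded for its bound [M]; the remaining [e * b] is the
    weight that [row_super] sums. *)
Lemma weight_sq_le (R : realFieldType) (e g b M v : R) :
  0 <= e * b <= M -> 0 <= v ->
  (e * g * b) ^+ 2 * v <= e * b * (M * (g ^+ 2 * v)).
Proof.
move=> /andP[eb0 ebM] v0.
have -> : (e * g * b) ^+ 2 * v = e * b * (e * b * (g ^+ 2 * v)) by ring.
by rewrite ler_wpM2l // ler_wpM2r // mulr_ge0 // sqr_ge0.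
Qed.

(** * Two-stage deviation bound under abstract smallness conditions *)

Section Deviation.
Variables (R : realType) (S : finType) (P : S -> S -> R) (r : S -> R).
Variables (gamma : R) (eta : nat -> R) (V0 : S -> R) (T : nat).
(** [E] bounds the contraction over a quarter of the horizon, [H] the learning rates after the first
    quarter, [K] is the crude error radius and [L] the tail exponent. *)
Variables (elow E H K L eps : R).
Hypothesis P_ge0 : forall s s', 0 <= P s s'.
Hypothesis P_sum1 : forall s, \sum_(s' : S) P s s' = 1.
Hypothesis r01 : forall s, 0 <= r s <= 1.
Hypothesis g01 : 0 <= gamma < 1.

Local Notation G := ((1 - gamma)^-1).
Local Notation Vs := (Vstar P r gamma).
Local Notation V := (td_path r gamma eta V0).
Local Notation rw := (prod_row P gamma eta).

Hypothesis V0_range : forall s, 0 <= V0 s <= G.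
Hypothesis T_gt1 : (1 < T)%N.
Hypothesis eta01 : forall t, (1 <= t <= T)%N -> 0 < eta t <= 1.
Hypothesis eta_low : forall j, (1 <= j <= T)%N -> elow <= eta j.
Hypothesis elow_ge0 : 0 <= elow.
Hypothesis elow1 : (1 - gamma) * elow <= 1.
Hypothesis contract : forall k, (T <= 4 * k)%N ->
  (1 - (1 - gamma) * elow) ^+ k <= E.
Hypothesis eta_high : forall j, (1 <= j <= T)%N -> (T < 4 * j)%N -> eta j <= H.
Hypothesis E_ge0 : 0 <= E.
Hypothesis E_le_H : E <= H.
Hypothesis K_gt0 : 0 < K.
Hypothesis K_sqr : K ^+ 2 = G.
Hypothesis L_gt0 : 0 < L.
Hypothesis eps_gt0 : 0 < eps.
Hypothesis bias_K : E * G <= K / 2.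
Hypothesis var_K : 8 * L * (H * G ^+ 3) <= (K / 2) ^+ 2.
Hypothesis range_K : 4 * L * (H * G) <= K / 2.
Hypothesis bias_eps : E * G <= eps / 2.
Hypothesis var_eps : 8 * L * (E * G ^+ 3 + 4 * H * G ^+ 2) <= (eps / 2) ^+ 2.
Hypothesis range_eps : 4 * L * (H * G) <= eps / 2.

Lemma eta_row_ge0 t s0 i s : (t <= T)%N -> (i < t)%N ->
  0 <= eta i.+1 * rw t s0 i.+1 s.
Proof.
move=> tT it; have /andP[e0 _] := eta01 (t := i.+1) (leq_trans it tT).
by rewrite mulr_ge0 ?(ltW e0) // (row_ge0 P_ge0 g01 s0 eta01 tT).
Qed.

Lemma eta_row_early t s0 i s : (t <= T)%N -> (i < t)%N ->
  (T <= 4 * (t - i.+1))%N -> eta i.+1 * rw t s0 i.+1 s <= E.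
Proof.
move=> tT it Tti; have /andP[e0 e1] := eta01 (t := i.+1) (leq_trans it tT).
have w0 := row_ge0 P_ge0 g01 s0 eta01 tT s it.
apply: le_trans (_ : rw t s0 i.+1 s <= _); first by rewrite ler_piMl.
apply: le_trans (row_le_mass P_ge0 g01 s0 eta01 tT s it) _.
apply: le_trans (contract Tti).
exact: (row_mass P_ge0 P_sum1 g01 s0 eta01 tT eta_low elow1 it).
Qed.

(** In the first quarter of the horizon, the row has contracted over at least [T / 4] steps; later,
    the learning rate itself is at most [H]. *)
Lemma eta_row_le t s0 i s : (T <= 2 * t)%N -> (t <= T)%N -> (i < t)%N ->
  eta i.+1 * rw t s0 i.+1 s <= H.
Proof.
move=> Tt tT it; have [Ti|iT] := ltnP T (4 * i.+1); last first.
  by apply: le_trans E_le_H; apply: eta_row_early => //; exact: quarter_gap.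
have i1T : (1 <= i.+1 <= T)%N by rewrite (leq_trans it tT).
have /andP[e0 e1] := eta01 i1T.
have w0 := row_ge0 P_ge0 g01 s0 eta01 tT s it.
apply: le_trans (_ : eta i.+1 <= _); last exact: eta_high.
rewrite ler_piMr ?(ltW e0) //.
apply: le_trans (row_le_mass P_ge0 g01 s0 eta01 tT s it) _.
apply: le_trans
  (row_mass P_ge0 P_sum1 g01 s0 eta01 tT eta_low elow1 it) _.
case/andP: (g01) => g0 g1.
rewrite exprn_ile1 ?subr_ge0 // gerBl mulr_ge0 // subr_ge0.
exact: ltW.
Qed.

Lemma bias_le t s0 : (T <= 2 * t)%N -> (t <= T)%N ->
  `|\sum_s rw t s0 0 s * (V0 s - Vs s)| <= E * G.
Proof.
move=> Tt tT; have G0 : 0 < G := G_gt0 g01.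
apply: le_trans (ler_norm_sum _ _ _) _.
apply: le_trans (_ : (\sum_s rw t s0 0 s) * G <= _); last first.
  rewrite ler_wpM2r ?(ltW G0) //.
  apply: le_trans
    (row_mass P_ge0 P_sum1 g01 s0 eta01 tT eta_low elow1 (leq0n t)) _.
  by apply: contract; rewrite subn0 (leq_trans Tt) // leq_mul2r orbT.
rewrite big_distrl; apply: ler_sum => s _ /=.
have w0 := row_ge0 P_ge0 g01 s0 eta01 tT s (leq0n t).
rewrite normrM (ger0_norm w0) ler_wpM2l // ler_norml.
have /andP[a0 aG] := V0_range s.
have /andP[b0 bG] := Vstar_range P_ge0 P_sum1 r01 g01 s.
by apply/andP; split; lra.
Qed.

(** Padding with zeros from [t] on lets the noise sums of all times share the sample space of
    horizon [T]. *)
Definition weight t s0 i s : R :=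
  if (i < t)%N then eta i.+1 * gamma * rw t s0 i.+1 s else 0.

Lemma mart_weight U t s0 p : (t <= T)%N ->
  mart P U (weight t s0) T p =
  \sum_(i < t) \sum_s eta i.+1 * gamma * rw t s0 i.+1 s *
     (U i p (p i s) - Pop P (U i p) s).
Proof.
move=> tT.
rewrite [RHS](big_ord_widen T (fun i => \sum_s eta i.+1 * gamma *
  rw t s0 i.+1 s * (U i p (p i s) - Pop P (U i p) s))) //.
rewrite [RHS]big_mkcond /mart; apply: eq_bigr => i _.
rewrite /weight; case: ifP => // _.
by rewrite big1 // => s _; rewrite mul0r.
Qed.

Lemma weight_var t s0 (v : nat -> S -> R) : (t <= T)%N ->
  \sum_(i < T) \sum_s weight t s0 i s ^+ 2 * v i s =
  \sum_(i < t) \sum_s (eta i.+1 * gamma * rw t s0 i.+1 s) ^+ 2 * v i s.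
Proof.
move=> tT.
rewrite [RHS](big_ord_widen T (fun i => \sum_s (eta i.+1 * gamma *
  rw t s0 i.+1 s) ^+ 2 * v i s)) //.
rewrite [RHS]big_mkcond; apply: eq_bigr => i _.
rewrite /weight; case: ifP => // _.
by rewrite big1 // => s _; rewrite expr0n mul0r.
Qed.

Lemma weight_range t s0 i s (U : S -> R) y : (T <= 2 * t)%N -> (t <= T)%N ->
  (forall y, 0 <= U y <= G) ->
  `|weight t s0 i s * (U y - Pop P U s)| <= H * G.
Proof.
move=> Tt tT UG; have G0 : 0 < G := G_gt0 g01.
have H0 : 0 <= H by apply: le_trans E_le_H.
rewrite /weight; case: ifP => it; last first.
  by rewrite mul0r normr0 mulr_ge0 // ltW.
have e0 := eta_row_ge0 s0 s tT it; have eH := eta_row_le s0 s Tt tT it.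
have /andP[a0 aG] := UG y; have /andP[b0 bG] := Pop_range P_ge0 P_sum1 s UG.
case/andP: (g01) => g0 g1.
rewrite normrM mulrAC (ger0_norm (mulr_ge0 e0 g0)); apply: ler_pM => //.
- exact: mulr_ge0.
- by apply: le_trans eH; rewrite ler_piMr // ltW.
- by rewrite ler_norml; apply/andP; split; lra.
Qed.

Lemma var_range (U : S -> R) s : (forall y, 0 <= U y <= G) ->
  varP P U s <= G ^+ 2.
Proof.
move=> UG; apply: varP_le_sqr => // y.
by have /andP[a0 aG] := UG y; rewrite ger0_norm.
Qed.

(* The constant [c * G] is a supersolution for the constant [c]. *)
Lemma row_super_cst t s0 c : (t <= T)%N -> 0 <= c ->
  \sum_(i < t) \sum_s eta i.+1 * rw t s0 i.+1 s * c <= c * G.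
Proof.
move=> tT c0; have G0 : 0 < G := G_gt0 g01.
apply: (row_super P_ge0 g01 s0 eta01 tT (h := fun=> c * G)) => s.
  by rewrite mulr_ge0 // ltW.
rewrite Pop_cst // -[leLHS]mulr1 -{1}(mulVf (_ : 1 - gamma != 0)).
  by rewrite le_eqVlt; apply/orP; left; apply/eqP; ring.
by case/andP: g01 => _ g1; rewrite subr_eq0 gt_eqF.
Qed.

(** The variance proxy [H * G ^+ 3] multiplies the maximal weight [H], the crude variance [G ^+ 2]
    and the total weight [G]. *)
Lemma crude_tail t s0 : (T <= 2 * t)%N -> (t <= T)%N ->
  \sum_(w : Omega S T | K / 2 < `|mart P V (weight t s0) T (sample w)|)
     prob P w <= 2 * expR (- L).
Proof.
move=> Tt tT; have G0 : 0 < G := G_gt0 g01.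
have H0 : 0 <= H by apply: le_trans E_le_H.
have VG i p s : (i < T)%N -> 0 <= V i p s <= G.
  by move=> iT; apply: (td_path_range r01 g01 p s eta01 V0_range (ltnW iT)).
apply: (@mart_tail_abs _ _ _ P_ge0 P_sum1 V _ _ (fun _ _ => G ^+ 2) T
   (H * G) (K / 2) L (H * G ^+ 3)) => //.
- by move=> i p q; exact: td_path_adapted.
- by rewrite divr_gt0.
- by move=> i p s y iT; apply: weight_range => // z; exact: VG.
- by move=> i p s iT; apply: var_range => z; exact: VG.
rewrite (weight_var s0 (fun _ _ => G ^+ 2) tT).
have -> : H * G ^+ 3 = H * G ^+ 2 * G by ring.
apply: le_trans (row_super_cst s0 tT (mulr_ge0 H0 (exprn_ge0 2 (ltW G0)))).
apply: ler_sum => -[i it] _ /=; apply: ler_sum => s _.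
case/andP: (g01) => g0 g1.
apply: le_trans (@weight_sq_le _ _ _ _ H _ _ _) _; last 1 first.
- rewrite ler_wpM2l ?eta_row_ge0 // ler_wpM2l // ler_piMl ?sqr_ge0 //.
  by rewrite exprn_ile1 // ltW.
- by rewrite eta_row_ge0 // eta_row_le.
- exact: sqr_ge0.
Qed.

(* Replacing [V_i] by [V^*] outside the event [|V_i - V^*| <= K] makes the
   conditional variances deterministically bounded. *)
Definition V_trunc (i : nat) (p : nat -> S -> S) : S -> R :=
  if (2 * i < T)%N || [forall s, `|V i p s - Vs s| <= K] then V i p else Vs.

(** Early indices can keep the crude variance because their weights are at most [E]. *)
Definition var_trunc (i : nat) (s : S) : R :=
  if (2 * i < T)%N then G ^+ 2 else 2 * varP P Vs s + 2 * K ^+ 2.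

Lemma varP_ge0 (U : S -> R) s : 0 <= varP P U s.
Proof. by apply: sumr_ge0 => y _; rewrite mulr_ge0 ?sqr_ge0. Qed.

Lemma V_trunc_range i p s : (i < T)%N -> 0 <= V_trunc i p s <= G.
Proof.
move=> iT; rewrite /V_trunc; case: ifP => _; last exact: Vstar_range.
exact: (td_path_range r01 g01 p s eta01 V0_range (ltnW iT)).
Qed.

Lemma varP_trunc i p s : (i < T)%N -> varP P (V_trunc i p) s <= var_trunc i s.
Proof.
move=> iT; rewrite /var_trunc; case: ifP => iearly.
  by apply: var_range => y; exact: V_trunc_range.
have K2 : 0 <= K ^+ 2 := sqr_ge0 K; have vv := varP_ge0 Vs s.
rewrite /V_trunc iearly /=; case: ifP => [/forallP VK|_]; last by lra.
have -> : V i p = fun y => Vs y + (V i p y - Vs y).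
  by apply/funext => y; rewrite addrC subrK.
apply: le_trans (varPD_le P_ge0 _ _ _) _.
by rewrite lerD // ler_pM2l // varP_le_sqr.
Qed.

(** Early indices give [E * G ^+ 2] times the total weight [G]. Late ones give [2 * H * K ^+ 2 * G],
    which is [2 * H * G ^+ 2], and [2 * H] times the sum that [var_super] bounds by [G ^+ 2]. *)
Lemma var_trunc_sum s0 :
  \sum_(i < T) \sum_s weight T s0 i s ^+ 2 * var_trunc i s
    <= E * G ^+ 3 + 4 * H * G ^+ 2.
Proof.
have G0 : 0 < G := G_gt0 g01; have H0 : 0 <= H by apply: le_trans E_le_H.
case/andP: (g01) => g0 g1.
have T2 : (T <= 2 * T)%N by rewrite leq_pmull.
have H20 : 0 <= 2 * H by rewrite mulr_ge0.
have HK : 0 <= 2 * H * K ^+ 2 := mulr_ge0 H20 (sqr_ge0 K).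
have EG : 0 <= E * G ^+ 2 := mulr_ge0 E_ge0 (sqr_ge0 G).
have g21 : gamma ^+ 2 <= 1 by rewrite exprn_ile1 // ltW.
rewrite weight_var //.
apply: le_trans (_ : \sum_(i < T) \sum_s (eta i.+1 * rw T s0 i.+1 s *
    (E * G ^+ 2 + 2 * H * K ^+ 2) + 2 * H * (eta i.+1 * rw T s0 i.+1 s *
    (gamma ^+ 2 * varP P Vs s))) <= _).
  apply: ler_sum => -[i it] _ /=; apply: ler_sum => s _.
  have w0 := eta_row_ge0 s0 s (leqnn T) it.
  have wH := eta_row_le s0 s T2 (leqnn T) it.
  have vv := varP_ge0 Vs s.
  rewrite /var_trunc; case: ifP => iearly.
    have wE := eta_row_early s0 s (leqnn T) it (half_gap T_gt1 iearly).
    apply: le_trans (@weight_sq_le _ _ _ _ E _ _ _) _; last 1 first.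
    - apply: le_trans (_ : eta i.+1 * rw T s0 i.+1 s * (E * G ^+ 2) <= _).
        by rewrite ler_wpM2l // ler_wpM2l // ler_piMl ?sqr_ge0.
      rewrite -[leLHS]addr0 lerD ?ler_wpM2l // ?lerDl.
        exact: HK.
      by rewrite mulr_ge0 // mulr_ge0 // mulr_ge0 // sqr_ge0.
    - by rewrite w0 wE.
    - exact: sqr_ge0.
  apply: le_trans (@weight_sq_le _ _ _ _ H _ _ _) _; last 1 first.
  - set w := eta i.+1 * _ in w0 wH *; set vs := varP P Vs s in vv *.
    have -> : w * (E * G ^+ 2 + 2 * H * K ^+ 2) + 2 * H * (w * (gamma ^+ 2 * vs))
      = w * (H * (gamma ^+ 2 * (2 * vs)) + (E * G ^+ 2 + 2 * H * K ^+ 2)) by ring.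
    rewrite ler_wpM2l // !mulrDr lerD2l.
    apply: le_trans (_ : 2 * H * K ^+ 2 <= _); last first.
      by rewrite lerDr.
    rewrite -mulrA [2 * (H * _)]mulrCA ler_wpM2l // mulrCA ler_pM2l //.
    by rewrite ler_piMl ?sqr_ge0.
  - by rewrite w0 wH.
  - by rewrite addr_ge0 // mulr_ge0 // sqr_ge0.
under eq_bigr do rewrite big_split -big_distrr /=.
rewrite big_split -big_distrr /=.
have c0 : 0 <= E * G ^+ 2 + 2 * H * K ^+ 2 := addr_ge0 EG HK.
have s1 := row_super_cst s0 (leqnn T) c0.
have s2 := row_super P_ge0 g01 s0 eta01 (leqnn T)
  (var_super_ge0 P_ge0 P_sum1 r01 g01) (var_superP P_ge0 P_sum1 r01 g01).
have s3 := le_trans s2 (var_super_le P r gamma s0).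
apply: le_trans (lerD s1 (ler_wpM2l H20 s3)) _.
by rewrite K_sqr le_eqVlt; apply/orP; left; apply/eqP; ring.
Qed.

Lemma final_tail s0 :
  \sum_(w : Omega S T | eps / 2 < `|mart P V_trunc (weight T s0) T (sample w)|)
     prob P w <= 2 * expR (- L).
Proof.
have T2 : (T <= 2 * T)%N by rewrite leq_pmull.
apply: (@mart_tail_abs _ _ _ P_ge0 P_sum1 V_trunc _ _ var_trunc T
   (H * G) (eps / 2) L (E * G ^+ 3 + 4 * H * G ^+ 2)) => //.
- by move=> i p q pq; rewrite /V_trunc (td_path_adapted _ _ _ _ pq).
- by rewrite divr_gt0.
- by move=> i p s y iT; apply: weight_range => // z; exact: V_trunc_range.
- by move=> i p s iT; exact: varP_trunc.
- exact: var_trunc_sum.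
Qed.

(** [Some t] marks the crude failure at time [t], empty before [T / 2]; [None] marks the failure of
    the truncated sum at time [T]. *)
Definition bad_event (i : option 'I_T.+1 * S) (w : Omega S T) : bool :=
  if i.1 is Some t then
    (T <= 2 * t)%N && (K / 2 < `|mart P V (weight t i.2) T (sample w)|)
  else eps / 2 < `|mart P V_trunc (weight T i.2) T (sample w)|.

Lemma error_le (w : Omega S T) : (forall i, ~~ bad_event i w) ->
  forall s, `|V T (sample w) s - Vs s| <= eps.
Proof.
move=> good s; set p := sample w.
have T2 : (T <= 2 * T)%N by rewrite leq_pmull.
have crude t y : (T <= 2 * t)%N -> (t <= T)%N -> `|V t p y - Vs y| <= K.
  move=> Tt tT; have := good (Some (inord t), y).
  rewrite /bad_event /= inordK // Tt /= -leNgt -/p => mK.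
  rewrite (error_decomp eta V0 P_ge0 P_sum1 r01 g01 t y p) -mart_weight //.
  apply: le_trans (ler_normD _ _) _.
  have b1 := le_trans (bias_le y Tt tT) bias_K.
  by apply: le_trans (lerD b1 mK) _; lra.
rewrite (error_decomp eta V0 P_ge0 P_sum1 r01 g01 T s p) -mart_weight //.
(* The bootstrap: every late iterate is within [K] of [Vs], so on this path the truncation never
   acts. *)
have -> : mart P V (weight T s) T p = mart P V_trunc (weight T s) T p.
  apply: eq_bigr => -[i iT] _ /=; rewrite /V_trunc.
  case: ltnP => //= iT2; rewrite ifT //; apply/forallP => y.
  by apply: crude => //; exact: ltnW.
apply: le_trans (ler_normD _ _) _.
have := good (None, s); rewrite /bad_event /= -leNgt -/p => me.
by apply: le_trans (lerD (le_trans (bias_le s T2 (leqnn T)) bias_eps) me) _; lra.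
Qed.

Lemma td_deviation :
  \sum_(w : Omega S T |
      ~~ [forall s, `|td w r gamma eta V0 T s - Vs s| <= eps]) prob P w
    <= #|S|%:R * T.+2%:R * (2 * expR (- L)).
Proof.
have -> : #|S|%:R * T.+2%:R = #|((option 'I_T.+1 * S)%type : finType)|%:R :> R.
  by rewrite card_prod card_option card_ord natrM mulrC.
apply: (sum_union_le (A := bad_event)) => [w|w nall|[[t|] s]].
- exact: prob_ge0.
- apply/existsP; apply: contraR nall; rewrite negb_exists => /forallP good.
  by apply/forallP => s; rewrite td_sample; exact: error_le.
- rewrite /bad_event /=; have [Tt|_] := leqP T (2 * t).
    by apply: crude_tail => //; rewrite -ltnS.
  by rewrite big_pred0_eq mulr_ge0 ?expR_ge0.
- exact: final_tail.
Qed.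

End Deviation.

(** * Numerical constants and learning-rate estimates *)

Section Constants.
Variable R : realType.

Lemma half_le_ln (x : R) : 2 <= x -> 2^-1 <= ln x.
Proof.
move=> x2; apply: (@le_trans _ _ (ln (2 : R))); last by rewrite ler_ln ?posrE; lra.
have h : (-1 : R) < - 2^-1 by lra.
have := le_ln1Dx h; rewrite (_ : 1 + - 2^-1 = 2^-1 :> R); last by field.
by rewrite lnV ?posrE //; lra.
Qed.

(* The choice [L = 3 L'], [H = 4 q], [K = sqrt G] meets every smallness
   condition of [td_deviation] as soon as [4000 q L' G^2 <= 2 eps^2]. *)
Lemma smallness (q Lp G K E eps : R) :
  0 <= q -> 2^-1 <= Lp -> 1 <= G -> 0 < eps <= 1 -> 0 <= E -> E * G <= q ->
  0 < K -> K ^+ 2 = G -> 4000 * (q * Lp * G ^+ 2) <= 2 * eps ^+ 2 ->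
  [/\ q <= 1, E <= 4 * q, E * G <= K / 2, E * G <= eps / 2 &
  [/\ 8 * (3 * Lp) * (4 * q * G ^+ 3) <= (K / 2) ^+ 2,
     4 * (3 * Lp) * (4 * q * G) <= K / 2,
     8 * (3 * Lp) * (E * G ^+ 3 + 4 * (4 * q) * G ^+ 2) <= (eps / 2) ^+ 2 &
     4 * (3 * Lp) * (4 * q * G) <= eps / 2]].
Proof.
move=> q0 Lp1 G1 /andP[e0 e1] E0 EG K0 KG key.
have K1 : 1 <= K.
  by rewrite -(@ler_pXn2r _ 2) ?nnegrE ?expr1n ?KG // ltW.
have Lp0 : 0 <= Lp by lra.
have G0 : 0 <= G by lra.
have ee : eps ^+ 2 <= eps by rewrite expr2 ler_piMl // ltW.
have G2 : 1 <= G ^+ 2 by rewrite exprn_ege1.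
(* Every condition is reduced to this quantity, which [key] bounds by [eps ^+ 2 / 2000]. *)
set m := q * Lp * G ^+ 2 in key.
have qL : 0 <= q * Lp by rewrite mulr_ge0.
have m1 : q * Lp * G <= m.
  by rewrite /m ler_wpM2l // expr2 ler_peMl.
have m2 : q <= 2 * m.
  apply: (@le_trans _ _ (2 * (q * Lp))).
    by have : q * 2^-1 <= q * Lp by [rewrite ler_wpM2l|]; lra.
  by rewrite ler_pM2l // /m ler_peMr.
have EE : E <= E * G by rewrite ler_peMr.
split; [lra|lra|lra|lra|split].
- rewrite expr_div_n KG.
  have -> : 8 * (3 * Lp) * (4 * q * G ^+ 3) = 96 * m * G by rewrite /m; ring.
  rewrite (_ : 2 ^+ 2 = 4); last by ring.
  rewrite mulrC ler_wpM2l //; lra.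
- have -> : 4 * (3 * Lp) * (4 * q * G) = 48 * (q * Lp * G) by ring.
  lra.
- have h : E * G * (Lp * G ^+ 2) <= m.
    by rewrite /m -[leRHS]mulrA ler_wpM2r // mulr_ge0 // sqr_ge0.
  (* The tightest condition: the total [408 * m] has to stay below [eps ^+ 2 / 4]. *)
  have -> : 8 * (3 * Lp) * (E * G ^+ 3 + 4 * (4 * q) * G ^+ 2) =
     24 * (E * G * (Lp * G ^+ 2)) + 384 * m by rewrite /m; ring.
  rewrite (_ : (eps / 2) ^+ 2 = eps ^+ 2 / 4); last by field.
  lra.
- have -> : 4 * (3 * Lp) * (4 * q * G) = 48 * (q * Lp * G) by ring.
  lra.
Qed.

(* [l] stands for [ln T] and [d] for [1 - gamma]. *)
Lemma rate_pow_le (c d l T : R) (k : nat) : 0 < c <= 48^-1 -> 0 < d <= 1 ->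
  2^-1 <= l -> 0 < T -> l ^+ 2 <= c * d * T -> T <= 4 * k%:R ->
  (1 - d * (1 / (1 + c * d * T / l ^+ 2))) ^+ k <= expR (- l).
Proof.
move=> /andP[c0 c1] /andP[d0 d1] l0 T0 lc Tk.
have lp : 0 < l by lra.
have l2 : 0 < l ^+ 2 by rewrite exprn_gt0.
have cdT : 0 < c * d * T by rewrite !mulr_gt0.
set e := 1 / _.
(* As [l ^+ 2 <= c * d * T], the 1 in the denominator at most doubles it. *)
have e_ge : l ^+ 2 / (2 * c * d * T) <= e.
  rewrite /e ler_pdivlMr; last by rewrite addr_gt0 // divr_gt0.
  rewrite -(ler_pM2r cdT) mul1r.
  have -> : l ^+ 2 / (2 * c * d * T) * (1 + c * d * T / l ^+ 2) * (c * d * T) =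
    (l ^+ 2 + c * d * T) / 2.
    by field; rewrite !gt_eqF.
  lra.
have X0 : 0 < 1 + c * d * T / l ^+ 2 by rewrite addr_gt0 // divr_gt0.
have e0 : 0 < e by rewrite /e div1r invr_gt0.
have e1 : e <= 1.
  by rewrite /e div1r invf_le1 // lerDl divr_ge0 // ltW.
have de1 : d * e <= 1 by rewrite mulr_ile1 // ltW.
(* The product is at least [l ^+ 2 / (8 * c)], which exceeds [l] for [c <= 48^-1] and
   [l >= 2^-1]. *)
have kl : l <= k%:R * (d * e).
  apply: (@le_trans _ _ (T / 4 * (d * (l ^+ 2 / (2 * c * d * T))))).
    have -> : T / 4 * (d * (l ^+ 2 / (2 * c * d * T))) = l * (l * (c^-1 / 8)).
      by field; rewrite !gt_eqF.
    rewrite ler_peMr //; first lra.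
    have : 48 <= c^-1 by rewrite -[leLHS]invrK lef_pV2 ?posrE.
    by nra.
  apply: ler_pM; [lra| |lra|by rewrite ler_pM2l].
  by rewrite mulr_ge0 ?divr_ge0 // ltW // ?mulr_gt0.
apply: (@le_trans _ _ (expR (- (d * e)) ^+ k)).
  rewrite lerXn2r ?nnegrE ?expR_ge0 // ?subr_ge0 //.
  exact: expR_ge1Dx.
by rewrite -expRM_natl ler_expR mulrN lerN2.
Qed.

(** Drop the 1 in the denominator; replacing [j] by [T / 4] gives the factor 4. *)
Lemma rate_upper (c d l T j x : R) : 0 < c -> 0 < d -> 0 < l -> 0 < T ->
  0 < j -> T <= 4 * j -> x <= 1 / (1 + c * d * j / l ^+ 2) ->
  x <= 4 * (l ^+ 2 / (c * d * T)).
Proof.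
move=> c0 d0 l0 T0 j0 Tj; move=> /le_trans; apply.
have l2 : 0 < l ^+ 2 by rewrite exprn_gt0.
have cd : 0 < c * d by rewrite mulr_gt0.
apply: (@le_trans _ _ (1 / (c * d * j / l ^+ 2))).
  rewrite !div1r lef_pV2 ?posrE ?addr_gt0 ?divr_gt0 ?mulr_gt0 //.
  by rewrite lerDr.
have -> : 1 / (c * d * j / l ^+ 2) = l ^+ 2 / (c * d * (T * j)) * T.
  by field; rewrite !gt_eqF.
have -> : 4 * (l ^+ 2 / (c * d * T)) = l ^+ 2 / (c * d * (T * j)) * (4 * j).
  by field; rewrite !gt_eqF.
by rewrite ler_wpM2l // divr_ge0 ?mulr_ge0 // ltW // mulr_gt0.
Qed.

(* Here [n] is the number of states, so that [y = exp (- L')]. *)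
Lemma union_mass (n : nat) (T : nat) (delta : R) : (0 < n)%N -> (1 < T)%N ->
  0 < delta < 1 ->
  n%:R * T.+2%:R * (2 * expR (- (3 * ln (n%:R * T%:R / delta)))) <= delta.
Proof.
move=> n0 T1 /andP[d0 d1].
have nR : 1 <= n%:R :> R by rewrite ler1n.
have TR : 2 <= T%:R :> R by rewrite ler_nat.
have T0 : 0 < T%:R :> R by lra.
have nT0 : 0 < n%:R * T%:R :> R by rewrite mulr_gt0 //; lra.
have nT2 : 2 <= n%:R * T%:R :> R.
  by apply: (le_trans TR); rewrite ler_peMl // ltW.
rewrite -mulrN expRM_natl expRN lnK ?posrE ?divr_gt0 //.
rewrite invf_div; set y := delta / _.
have y0 : 0 < y by rewrite divr_gt0.
have y2 : y <= 2^-1.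
  by rewrite /y ler_pdivrMr //; lra.
have yd : n%:R * T%:R * y = delta by rewrite /y mulrC divfK // gt_eqF.
have T2 : T.+2%:R <= 2 * T%:R :> R by rewrite -addn2 natrD; lra.
apply: (@le_trans _ _ (n%:R * (2 * T%:R) * (2 * y ^+ 3))).
  have y3 : 0 <= 2 * y ^+ 3 by rewrite mulr_ge0 // exprn_ge0 // ltW.
  by apply: ler_wpM2r => //; apply: ler_wpM2l.
(* One factor [y] turns [n * T] into [delta]; the other two absorb the constant 4. *)
have -> : n%:R * (2 * T%:R) * (2 * y ^+ 3) = (n%:R * T%:R * y) * (4 * y ^+ 2) by ring.
rewrite yd ler_piMr ?(ltW d0) //.
have : y ^+ 2 <= 2^-1 ^+ 2 by rewrite lerXn2r ?nnegrE // ltW.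
by rewrite (_ : 2^-1 ^+ 2 = 4^-1 :> R); [lra|field].
Qed.

End Constants.

(** * Choice of the universal constants and assembly *)

Unset Implicit Arguments.

Theorem theorem1 (R : realType) :
  exists c0 : R, 0 < c0 /\
  forall c1 c2 : R, 0 < c2 -> c2 <= c1 -> c1 <= c0 ->
  exists c3 : R, 0 < c3 /\
  forall (S : finType) (P : S -> S -> R) (r : S -> R) (gamma delta eps : R)
         (T : nat) (eta : nat -> R) (V0 : S -> R),
    (forall s s', 0 <= P s s') ->
    (forall s, \sum_(s' : S) P s s' = 1) ->
    (forall s, 0 <= r s <= 1) ->
    0 < delta < 1 ->
    0 < eps <= 1 ->
    2^-1 <= gamma < 1 ->
    (1 < T)%N ->
    (forall t : nat, (1 <= t <= T)%N -> 0 < eta t <= 1) ->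
    (forall t : nat, (t <= T)%N ->
       1 / (1 + c1 * (1 - gamma) * T%:R / (ln (T%:R : R)) ^+ 2) <= eta t /\
       eta t <= 1 / (1 + c2 * (1 - gamma) * t%:R / (ln (T%:R : R)) ^+ 2)) ->
    (T%:R >= c3 * (ln (T%:R : R)) ^+ 3 * ln (#|S|%:R * T%:R / delta)
              / ((1 - gamma) ^+ 3 * eps ^+ 2)) ->
    (forall s, 0 <= V0 s <= 1 / (1 - gamma)) ->
    \sum_(w : Omega S T |
          [forall s : S, `|td w r gamma eta V0 T s - Vstar P r gamma s| <= eps])
        prob P w
      >= 1 - delta.
Proof.
exists 48^-1; split; first by rewrite invr_gt0.
(* Dividing by [c2] cancels the [c2] in the denominator of [q] below. *)
move=> c1 c2 c2_gt0 c21 c1_le; exists (4000 / c2); split.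
  by apply: divr_gt0; rewrite ?ltr0n.
move=> S P r gamma delta eps T eta V0 P_ge0 P_sum1 r01 d01 e01 gh T1 eta01
  eta_bd T_ge V0_range.
have c1_gt0 : 0 < c1 := lt_le_trans c2_gt0 c21.
have /andP[gl g1] := gh; have /andP[eps0 eps1] := e01.
have /andP[delta0 delta1] := d01.
have g0 : 0 <= gamma by apply: le_trans gl; rewrite invr_ge0.
have g01 : 0 <= gamma < 1 by rewrite g0.
pose bad := \sum_(w : Omega S T | ~~ [forall s : S,
  `|td w r gamma eta V0 T s - Vstar P r gamma s| <= eps]) prob P w.
suff bad_le : bad <= delta.
  have := prob_sum1 P_sum1 T; rewrite (bigID (fun w : Omega S T => [forall s : S,
    `|td w r gamma eta V0 T s - Vstar P r gamma s| <= eps])) /= -/bad => <-.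
  by rewrite lerBlDr lerD2l.
(* With no states the error bound holds vacuously; the logarithmic estimates below use at least one
   state. *)
have [S0|S_gt0] := posnP #|S|.
  rewrite /bad big_pred0 ?ltW // => w; apply/negbTE; rewrite negbK.
  by apply/forallP => s; have := fintype0 s; rewrite S0.
have TR : 2 <= T%:R :> R by rewrite ler_nat.
have T0 : 0 < T%:R :> R by rewrite ltr0n ltnW.
set l := ln (T%:R : R) in eta_bd T_ge.
set d := 1 - gamma in eta_bd T_ge V0_range.
set Lp := ln _ in T_ge.
have d0 : 0 < d by rewrite /d subr_gt0.
have d1 : d <= 1 by rewrite /d gerBl.
have l_ge : 2^-1 <= l by apply: half_le_ln.
have h0 : 0 < 2^-1 :> R by rewrite invr_gt0.
have l0 : 0 < l := lt_le_trans h0 l_ge.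
have S1 : 1 <= #|S|%:R :> R by rewrite ler1n.
have T_le : T%:R <= #|S|%:R * T%:R / delta.
  rewrite ler_pdivlMr //; apply: (@le_trans _ _ T%:R).
    by rewrite ler_piMr // ltW.
  by rewrite ler_peMl // ltW.
have Lp_ge : 2^-1 <= Lp by apply: half_le_ln; apply: le_trans T_le.
have Lp0 : 0 < Lp := lt_le_trans h0 Lp_ge.
(* [4 * q] bounds the learning rates after the first quarter of the horizon. *)
pose q := l ^+ 2 / (c2 * d * T%:R); pose G := d^-1; pose K := Num.sqrt G.
have cdT : 0 < c2 * d * T%:R by rewrite !mulr_gt0.
have q0 : 0 <= q by rewrite divr_ge0 ?sqr_ge0 // ltW.
have G0 : 0 < G by rewrite invr_gt0.
have G1 : 1 <= G by rewrite invf_ge1.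
have K0 : 0 < K by rewrite sqrtr_gt0.
have KG : K ^+ 2 = G by rewrite sqr_sqrtr // ltW.
have key : 4000 * (q * Lp * G ^+ 2) <= 2 * eps ^+ 2.
  have D0 : 0 < d ^+ 3 * eps ^+ 2 by rewrite mulr_gt0 ?exprn_gt0.
  move: T_ge; rewrite ler_pdivrMr // => T_ge.
  have TT : 4000 * (l ^+ 2 * l) * Lp <= T%:R * (d ^+ 3 * eps ^+ 2) * c2.
    rewrite -ler_pdivrMr //; apply: le_trans T_ge.
    by rewrite le_eqVlt; apply/orP; left; apply/eqP; field; rewrite gt_eqF.
  have -> : 4000 * (q * Lp * G ^+ 2) =
      4000 * (l ^+ 2 * Lp) / (c2 * d ^+ 3 * T%:R).
    by rewrite /q /G; field; rewrite !gt_eqF.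
  rewrite ler_pdivrMr ?mulr_gt0 ?exprn_gt0 //.
  have -> : 2 * eps ^+ 2 * (c2 * d ^+ 3 * T%:R) =
      2 * (T%:R * (d ^+ 3 * eps ^+ 2) * c2) by ring.
  (* The third power of the logarithm is spent through [1 <= 2 * l], whence the factor 2 in
     [key]. *)
  apply: (@le_trans _ _ (2 * (4000 * (l ^+ 2 * l) * Lp))); last by rewrite ler_pM2l.
  have -> : 2 * (4000 * (l ^+ 2 * l) * Lp) = 4000 * (l ^+ 2 * Lp) * (2 * l) by ring.
  have l2L : 0 <= l ^+ 2 * Lp by rewrite mulr_ge0 ?sqr_ge0 // ltW.
  by apply: ler_peMr; [apply: mulr_ge0; [rewrite ler0n | ] |
    rewrite -ler_pdivrMl // mulr1].
(* Here [E] is [expR (- l)], that is [1 / T]; the claim amounts to [c2 <= l ^+ 2], true since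
   [c2 <= 1/4]. *)
have EG : T%:R^-1 * G <= q.
  have -> : q = T%:R^-1 * G * (l ^+ 2 / c2).
    by rewrite /q /G; field; rewrite !gt_eqF.
  apply: ler_peMr; first by rewrite mulr_ge0 ?invr_ge0 // ltW.
  rewrite ler_pdivlMr // mul1r.
  have c2q : c2 <= 2^-1 ^+ 2.
    apply: (le_trans c21); apply: (le_trans c1_le).
    by rewrite exprVn lef_pV2 ?posrE ?exprn_gt0 // -natrX ler_nat.
  by apply: (le_trans c2q); rewrite lerXn2r ?nnegrE // ltW.
have E0 : 0 <= T%:R^-1 :> R by rewrite invr_ge0 ltW.
have [q1 E4q bK be [vK rK ve re]] := smallness q0 Lp_ge G1 e01 E0 EG K0 KG key.
(* This is [q <= 1] together with [c2 <= c1]. *)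
have lcd : l ^+ 2 <= c1 * d * T%:R.
  apply: (@le_trans _ _ (c2 * d * T%:R)); last by rewrite !ler_pM2r.
  by move: q1; rewrite ler_pdivrMr ?mul1r.
pose elow := 1 / (1 + c1 * d * T%:R / l ^+ 2).
have X0 : 0 <= c1 * d * T%:R / l ^+ 2 by rewrite divr_ge0 ?sqr_ge0 ?mulr_ge0 // ltW.
have elow0 : 0 <= elow by rewrite divr_ge0 // addr_ge0.
have elow1 : elow <= 1 by rewrite /elow div1r invf_le1 ?lerDl // ltr_wpDr.
apply: le_trans (union_mass S_gt0 T1 d01).
rewrite -/Lp.
apply: (@td_deviation R S P r gamma eta V0 T elow T%:R^-1 (4 * q) K) => //.
- by move=> s; rewrite -/d -div1r.
- by move=> j /andP[_ jT]; case: (eta_bd j jT).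
- by apply: mulr_ile1 => //; exact: ltW.
- move=> k Tk; rewrite -[X in _ <= X](_ : expR (- l) = _); last first.
    by rewrite expRN lnK.
  apply: rate_pow_le => //; first by rewrite c1_gt0.
  + by rewrite d0.
  + by rewrite -natrM ler_nat.
- move=> j /andP[j0 jT] Tj; have [_ hj] := eta_bd j jT.
  apply: rate_upper hj => //; first by rewrite ltr0n.
  by rewrite -natrM ler_nat ltnW.
- by rewrite mulr_gt0.
Qed.
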